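(* Let $\varphi^\star(\lambda,g)$ be the dual function of the KLQ program with subspace relaxation (defined in the context), and $\varphi^\star(\lambda)=\max_g\varphi^\star(\lambda,g)$. For each $\lambda\in\mathbb R^N$: (i) A maximizer $g^\lambda\in\arg\max_g\varphi^\star(\lambda,g)$ is given by the recursion $g_k^\lambda=\mathcal T_k^\lambda(g_{k+1}^\lambda)$, $1\le k\le K$, where $g_{K+1}^\lambda\equiv0$. (ii) The maximum of the dual function over $g$ is the concave function $$\varphi^\star(\lambda)=\lambda^T\hat r-\frac{1}{2\kappa}\|\lambda\|^2-\langle\nu_0^0,G_1^\lambda\rangle .$$ (iii) The function $\varphi^\star(\lambda)$ is continuously differentiable, and $$\frac{\partial}{\partial\lambda_n}\varphi^\star(\lambda)=\hat r_n-\frac1\kappa\lambda_n-\sum_{k=1}^Kw_n(k)\langle\nu_k^\lambda,\mathcal Y\rangle,\qquad 1\le n\le N,$$ where $\{\nu_k^\lambda\}$ is the sequence of marginals obtained from the randomized policy $$\phi_k^\lambda(u\mid s)=\phi_k^0(u\mid s)\exp\Big(\sum_{s'}T_k((s,u),s')g_{k+1}^\lambda(s')+\check\lambda_k\mathcal Y(s,u)-g_k^\lambda(s)\Big),\quad 1\le k\le K,$$ with $g^\lambda$ as in (i).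
   Context: $\mathsf S$ and $\mathsf U$ are finite sets and $\mathsf X=\mathsf S\times\mathsf U$, $x=(s,u)$. Fix integers $K,N\ge1$, $\kappa>0$, $\mathcal Y:\mathsf X\to\mathbb R$, $r_1,\dots,r_K\in\mathbb R$, functions $w_n:\{0,\dots,K\}\to\mathbb R$ ($1\le n\le N$), $\hat r\in\mathbb R^N$ with $\hat r_n=\sum_{k=1}^Kw_n(k)r_k$, controlled transition matrices $T_k$ ($T_k(x,\cdot)$ a pmf on $\mathsf S$), an initial pmf $\nu_0^0$ on $\mathsf X$, and nominal randomized policies $\phi_k^0(u\mid s)$, with nominal marginals $\nu_k^0$. $\langle\nu,f\rangle=\sum_x\nu(x)f(x)$. The KLQ program with subspace relaxation is: minimize $\sum_{k=1}^K\mathcal D(\nu_k,\nu_k^0)+\frac\kappa2\sum_{n=1}^N\gamma_n^2$ over pmfs $\nu_k$ on $\mathsf X$ and $\gamma\in\mathbb R^N$, subject to $\gamma_n=\sum_kw_n(k)\langle\nu_k,\mathcal Y\rangle-\hat r_n$ and $\sum_{u'}\nu_k(s',u')=\sum_{s,u}\nu_{k-1}(s,u)T_{k-1}((s,u),s')$, $\nu_0=\nu_0^0$. Here $\mathcal D(\nu_k,\nu_k^0)=\sum_{s,u}\nu_k(s,u)\log(\phi_k(u\mid s)/\phi_k^0(u\mid s))$ with $\phi_k$ the conditional pmf of $u$ given $s$ under $\nu_k$. For $\lambda\in\mathbb R^N$ and $g=(g_1,\dots,g_K)$, $g_k:\mathsf S\to\mathbb R$, the Lagrangian is $$\mathcal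 L(\nu,\gamma,\lambda,g)=\sum_{k=1}^K\mathcal D(\nu_k,\nu_k^0)+\frac{\kappa}{2}\sum_{n=1}^N\gamma_n^2+\sum_{n=1}^N\lambda_n\Big(\gamma_n+\sum_{k=1}^Kw_n(k)[r_k-\langle\nu_k,\mathcal Y\rangle]\Big)+\sum_{k=1}^K\sum_{s'}\Big(\sum_{u'}\nu_k(s',u')-\sum_{s,u}\nu_{k-1}(s,u)T_{k-1}((s,u),s')\Big)g_k(s'),$$ and $\varphi^\star(\lambda,g)=\min_{\nu,\gamma}\mathcal L(\nu,\gamma,\lambda,g)$ (over all pmfs $\nu_1,\dots,\nu_K$ on $\mathsf X$ and $\gamma\in\mathbb R^N$, with $\nu_0=\nu_0^0$ fixed). For $f:\mathsf S\to\mathbb R$, $$\mathcal T_k^\lambda(f;s)=\log\Big(\sum_u\phi_k^0(u\mid s)\exp\Big(\sum_{s'}T_k((s,u),s')f(s')+\check\lambda_k\mathcal Y(s,u)\Big)\Big),\qquad\check\lambda_k=\sum_{n=1}^N\lambda_nw_n(k),$$ and $\mathcal T_k^\lambda(f)$ denotes the function $s\mapsto\mathcal T_k^\lambda(f;s)$. Also $G_k^\lambda(x)=\sum_sT_{k-1}(x,s)g_k^\lambda(s)$. The marginals of a policy $\{\phi_k\}$ are $\nu_k(s',u')=\sum_x\nu_{k-1}(x)T_{k-1}(x,s')\phi_k(u'\mid s')$, $\nu_0=\nu_0^0$. *)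

(* Defs.v *)
From HB Require Import structures.
From mathcomp Require Import all_boot all_order all_algebra.
From mathcomp Require Import all_classical all_reals all_analysis.

Set Implicit Arguments.
Unset Strict Implicit.
Unset Printing Implicit Defensive.

Import Order.TTheory GRing.Theory Num.Theory.
Import numFieldNormedType.Exports.

Local Open Scope classical_set_scope.
Local Open Scope ring_scope.

Definition is_pmf (R : realType) (A : finType) (p : A -> R) : Prop :=
  (forall a, 0 <= p a) /\ \sum_a p a = 1.

Definition pairing (R : realType) (A : finType) (nu f : A -> R) : R :=
  \sum_a nu a * f a.

Definition concave_function (R : realType) (E : lmodType R) (f : E -> R) : Prop :=
  @convex_function R E setT (fun x => - f x).

Definition partial_derivative (R : realType) (N : nat) (n : 'I_N)
    (f : 'cV[R]_N -> R) (x : 'cV[R]_N) : R :=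
  'D_(delta_mx n 0) f x.

Definition continuously_differentiable (R : realType) (N : nat)
    (f : 'cV[R]_N -> R) : Prop :=
  (forall x, differentiable f x) /\
  (forall n, continuous (partial_derivative n f)).

Section KLQ.
Context {R : realType} {S U : finType}.

(* The value is immaterial when [s] has zero marginal probability, since it is
   only used with the weight [nu (s, u)]. *)
Definition cond_pmf (nu : S * U -> R) (s : S) (u : U) : R :=
  nu (s, u) / \sum_u' nu (s, u').

(* In \bar R, [0 * _ = 0], [lne 0 = -oo] and [p%:E / 0 = +oo] for [p > 0]:
   terms with [nu (s, u) = 0] vanish, and the value is +oo when [nu] charges
   some [(s, u)] with [phi0 s u = 0]. *)
Definition rel_entropy (nu : S * U -> R) (phi0 : S -> U -> R) : \bar R :=
  (\sum_s \sum_u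
    (nu (s, u))%:E * lne ((cond_pmf nu s u)%:E / (phi0 s u)%:E))%E.

(* Time-indexed data are functions on [nat]: only the indices 0..K (for [T],
   [w], [nu]) and 1..K (for [r], [phi0], multipliers) are meaningful. *)
Context (K : nat) {N : nat} (kappa : R) (Y : S * U -> R).
Context (r : nat -> R) (w : 'I_N -> nat -> R).
Context (T : nat -> S * U -> S -> R) (nu00 : S * U -> R).
Context (phi0 : nat -> S -> U -> R).

Definition lagrangian (nu : nat -> S * U -> R) (gam lam : 'cV[R]_N)
    (g : nat -> S -> R) : \bar R :=
  (\sum_(1 <= k < K.+1) rel_entropy (nu k) (phi0 k)
   + (kappa / 2 * (\sum_n gam n 0 ^+ 2)
      + \sum_n lam n 0 *
          (gam n 0 + \sum_(1 <= k < K.+1) w n k * (r k - pairing (nu k) Y))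
      + \sum_(1 <= k < K.+1) \sum_s'
          (\sum_u' nu k (s', u')
           - \sum_s \sum_u nu k.-1 (s, u) * T k.-1 (s, u) s') * g k s')%R%:E)%E.

Definition pmf_sequences : set (nat -> S * U -> R) :=
  [set nu | nu 0%N = nu00 /\ forall k, (1 <= k <= K)%N -> is_pmf (nu k)].

Definition dual_function (lam : 'cV[R]_N) (g : nat -> S -> R) : \bar R :=
  ereal_inf [set lagrangian nu gam lam g
            | nu in pmf_sequences & gam in [set: 'cV[R]_N]].

Definition max_dual (lam : 'cV[R]_N) : \bar R :=
  ereal_sup [set dual_function lam g | g in [set: nat -> S -> R]].

Definition lam_check (lam : 'cV[R]_N) (k : nat) : R :=
  \sum_n lam n 0 * w n k.

Definition soft_bellman (lam : 'cV[R]_N) (k : nat) (f : S -> R) (s : S) : R :=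
  ln (\sum_u phi0 k s u *
        expR (\sum_s' T k (s, u) s' * f s' + lam_check lam k * Y (s, u))).

(* [g_backward lam j] is g_(K + 1 - j). *)
Fixpoint g_backward (lam : 'cV[R]_N) (j : nat) : S -> R :=
  if j is j'.+1 then soft_bellman lam (K - j') (g_backward lam j')
  else fun=> 0.

Definition g_opt (lam : 'cV[R]_N) (k : nat) : S -> R :=
  g_backward lam (K.+1 - k).

Definition G_opt (lam : 'cV[R]_N) (k : nat) (x : S * U) : R :=
  \sum_s T k.-1 x s * g_opt lam k s.

Fixpoint marginals (phi : nat -> S -> U -> R) (k : nat) : S * U -> R :=
  if k is k'.+1 then
    fun x' => \sum_x marginals phi k' x * T k' x x'.1 * phi k x'.1 x'.2
  else nu00.

Definition policy_opt (lam : 'cV[R]_N) (k : nat) (s : S) (u : U) : R :=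
  phi0 k s u *
  expR (\sum_s' T k (s, u) s' * g_opt lam k.+1 s'
        + lam_check lam k * Y (s, u) - g_opt lam k s).

End KLQ.

(* Main.v *)
Require Import Defs.
From HB Require Import structures.
From mathcomp Require Import all_boot all_order all_algebra.
From mathcomp Require Import all_classical all_reals all_analysis.
From mathcomp Require Import ring lra.

Set Implicit Arguments.
Unset Strict Implicit.
Unset Printing Implicit Defensive.

Import Order.TTheory GRing.Theory Num.Theory.
Import numFieldNormedType.Exports.

Local Open Scope classical_set_scope.
Local Open Scope ring_scope.

(** The dual function is computed by the Gibbs variational principle, and all
    its regularity comes from one supergradient inequality.

    Fix the multipliers lam and h, set h (K+1) = 0, and let V_k be the soft
    Bellman operator applied to h (k+1). Exponential tilting of phi0 k by the
    expected h (k+1) plus the weighted reward, normalised by exp V_k, gives a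
    policy ([tilted]). A summation by parts over time moves the flow
    constraints onto the occupation measures ([finite_part_tilt]), and the
    Lagrangian becomes: a quadratic cost in gam, plus terms that depend on lam
    and h alone, plus the relative entropy of each nu k with respect to its
    tilted policy, plus the average under nu k of the Bellman gap h k - V_k.
    Relative entropies are nonnegative ([gibbs]) and vanish at the tilted
    policy ([gibbs_eq]). So the Lagrangian is minimised by gam = - lam / kappa
    and by letting nu k charge a single state, where the Bellman gap is
    smallest, with the tilted conditional law of the control
    ([dual_attained]).

    If h solves the recursion, the gaps vanish and the dual value is the
    announced closed form ([dual_g_opt]). No h does better: the marginals of
    the tilted policy satisfy the flow constraints, hence the Lagrangian at
    these marginals does not depend on h, and its value for every h is that
    same closed form ([lagrangian_saddle]).

    The same evaluation gives the regularity. At fixed balanced marginals and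
    fixed gam the Lagrangian is affine in lam, so the marginals that are
    optimal for lam bound the dual optimum at any lam' from above by an affine
    function of lam' that is exact at lam ([opt_value_supergradient]). Its
    slope, the residual of the moment constraints, is therefore a
    supergradient; existence of supergradients everywhere gives concavity, and
    a supergradient that depends continuously on the point is the gradient
    ([supergradient_C1]). Continuity in lam holds because the recursion and
    the marginals are compositions of sums, products, exponentials and
    logarithms of positive sums. *)

(** * Functions with a continuous supergradient *)

Section Supergradient.
Context {R : realType} {N : nat}.
Implicit Types (x y : 'cV[R]_N) (f : 'cV[R]_N -> R) (d : 'cV[R]_N -> 'I_N -> R).

Definition linear_form (a : 'I_N -> R) (v : 'cV[R]_N) : R :=
  \sum_n v n 0 * a n.

Lemma linear_formP a c u v :
  linear_form a (c *: u + v) = c * linear_form a u + linear_form a v.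
Proof.
rewrite /linear_form mulr_sumr -big_split /=.
by apply: eq_bigr => n _; rewrite !mxE mulrDl mulrA.
Qed.

Lemma linear_form_is_linear a : linear (linear_form a).
Proof. exact: linear_formP. Qed.

HB.instance Definition _ a :=
  GRing.isLinear.Build R 'cV[R]_N R *:%R (linear_form a) (linear_form_is_linear a).

Lemma linear_formZ a c v : linear_form a (c *: v) = c * linear_form a v.
Proof. by rewrite -[c *: v]addr0 linear_formP linear0 addr0. Qed.

Lemma linear_formN a v : linear_form a (- v) = - linear_form a v.
Proof. by rewrite -scaleN1r linear_formZ mulN1r. Qed.

Lemma linear_formB a b v :
  linear_form (fun n => a n - b n) v = linear_form a v - linear_form b v.
Proof. by rewrite /linear_form -sumrB; apply: eq_bigr => n _; rewrite mulrBr. Qed.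

Lemma linear_form_le_norm a v : `|linear_form a v| <= (\sum_n `|a n|) * `|v|.
Proof.
rewrite /linear_form mulr_suml (le_trans (ler_norm_sum _ _ _))//.
apply: ler_sum => n _; rewrite normrM mulrC ler_wpM2l//.
have := @mx_normrE R N 1 v; rewrite /Num.norm /= => ->.
exact: (le_bigmax _ (fun ij : 'I_N * 'I_1 => `|v ij.1 ij.2|) (n, 0)).
Qed.

Lemma continuous_at_sum {V : topologicalType} {I : Type} (s : seq I)
    (F : V -> I -> R) (x : V) :
  (forall i, {for x, continuous (F ^~ i)}) ->
  {for x, continuous (fun z => \sum_(i <- s) F z i)}.
Proof.
by move=> Fx; apply: cvg_big => [|i _]; [exact: add_continuous|exact: Fx].
Qed.

Lemma linear_form_continuous a : continuous (linear_form a).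
Proof.
move=> v; apply: continuous_at_sum => n.
exact: (continuousM (@coord_continuous R N 1 n 0 v)
         (@cst_continuous _ _ (a n) v)).
Qed.

Definition supergradient f d :=
  forall x y, f y <= f x + linear_form (d x) (y - x).

(** The inequality is applied at the convex combination z of x and y, towards x
    and towards y; the two linear terms cancel in the average since z is the
    barycentre. *)
Lemma supergradient_concave f d : supergradient f d -> concave_function f.
Proof.
move=> fd t x y _ _; rewrite /conv /= lerNl opprD -!scalerN !opprK.
set z := (_ + _ : 'cV[R]_N).
have [t0 t1] : 0 <= t%:num /\ 0 <= 1 - t%:num by rewrite subr_ge0.
have := lerD (ler_wpM2l t0 (fd z x)) (ler_wpM2l t1 (fd z y)).
suff -> : t%:num * (f z + linear_form (d z) (x - z)) +
   (1 - t%:num) * (f z + linear_form (d z) (y - z)) = f z by [].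
transitivity (f z +
    linear_form (d z) (t%:num *: (x - z) + (1 - t%:num) *: (y - z))).
  rewrite linear_formP linear_formZ.
  move: (linear_form (d z) (x - z)) (linear_form (d z) (y - z)) => p q; ring.
suff -> : t%:num *: (x - z) + (1 - t%:num) *: (y - z) = 0.
  by rewrite linear0 addr0.
have zE n : z n 0 = t%:num * x n 0 + (1 - t%:num) * y n 0 by rewrite !mxE.
by clearbody z; apply/colP => n; rewrite !mxE zE; ring.
Qed.

Lemma differentiable_of_bound (V W : normedModType R) (f : V -> W)
    (df : {linear V -> W}) (x : V) : continuous df ->
  (forall e, 0 < e -> \forall h \near (0 : V),
     `|f (h + x) - (f x + df h)| <= e * `|h|) ->
  differentiable f x /\ 'd f x = df :> (V -> W).
Proof.
move=> dfc fdf.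
have fx : f \o shift x = cst (f x) + df +o_ (0 : V) id.
  by apply/eqaddoP => e e0; exact: fdf.
have dfE := diff_unique dfc fx.
by split=> //; apply/diff_locallyP; rewrite dfE.
Qed.

(** The inequality from x to h + x bounds the remainder above by 0, and the
    inequality from h + x back to x bounds it below by the increment of d
    paired with h. *)
Lemma supergradient_remainder f d x h : supergradient f d ->
  `|f (h + x) - (f x + linear_form (d x) h)| <=
    (\sum_n `|d (h + x) n - d x n|) * `|h|.
Proof.
move=> fd; have lower := fd x (h + x); have upper := fd (h + x) x.
rewrite addrK in lower; rewrite opprD addrCA subrr addr0 linear_formN in upper.
apply: le_trans (linear_form_le_norm _ _); rewrite linear_formB.
rewrite ler0_norm; last lra.
by rewrite -[leRHS]normrN (le_trans _ (ler_norm _))//; lra.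
Qed.

Lemma supergradient_diff f d x :
  supergradient f d -> (forall n, {for x, continuous (d ^~ n)}) ->
  differentiable f x /\ 'd f x = linear_form (d x) :> ('cV[R]_N -> R).
Proof.
move=> fd dc.
apply: differentiable_of_bound; first exact: linear_form_continuous.
move=> e e0.
have hc : {for (0 : 'cV[R]_N),
    continuous (fun h : 'cV[R]_N => \sum_n `|d (h + x) n - d x n|)}.
  apply: continuous_at_sum => n.
  have dn : {for 0 + x, continuous (d ^~ n)} by rewrite add0r; exact: dc.
  have shx : {for (0 : 'cV[R]_N), continuous (fun h : 'cV[R]_N => h + x)}.
    have idc : {for (0 : 'cV[R]_N), continuous id} by move=> A.
    exact: (continuousD idc (@cst_continuous 'cV[R]_N _ x 0)).
  have dshx := continuous_comp shx dn.
  exact: (cvg_norm (cvgB dshx (cvg_cst (d x n)))).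
have hlt : \forall h \near (0 : 'cV[R]_N),
    \sum_n `|d (h + x) n - d x n| < e.
  apply: (cvgr_lt _ hc); rewrite big1 // => n _.
  by rewrite add0r subrr normr0.
near=> h.
have bound : (\sum_n `|d (h + x) n - d x n|) * `|h| <= e * `|h|.
  by rewrite ler_wpM2r// ltW//; near: h; exact: hlt.
exact: (le_trans (supergradient_remainder x h fd) bound).
Unshelve. all: by end_near.
Qed.

Lemma linear_form_delta a n : linear_form a (delta_mx n 0) = a n.
Proof.
rewrite /linear_form (bigD1 n)//= big1 => [|i in_]; rewrite mxE !eqxx/=.
  by rewrite mul1r addr0.
by rewrite (negPf in_) mul0r.
Qed.

Lemma supergradient_C1 f d :
  supergradient f d -> (forall n, continuous (d ^~ n)) ->
  continuously_differentiable f /\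
  forall x n, partial_derivative n f x = d x n.
Proof.
move=> fd dc.
have pd x n : partial_derivative n f x = d x n.
  have [df dfE] := supergradient_diff fd (fun n => dc n x).
  by rewrite /partial_derivative deriveE// dfE linear_form_delta.
split=> //; split=> [x|n].
  by have [] := supergradient_diff fd (fun n => dc n x).
rewrite (_ : partial_derivative n f = d ^~ n); first exact: dc.
by apply/funext => x; exact: pd.
Qed.

End Supergradient.

(** * The Gibbs variational principle *)

Section Gibbs.
Context {R : realType} {S U : finType}.

(** This is ln q <= q - 1 with q = m f exp e / p. The correction p - m f exp e
    sums to 0 over the controls when f exp e is a probability, which is what
    makes the termwise bound useful. If p > 0 = f the right-hand side is
    +oo. *)
Lemma gibbs_term (p m f e : R) : 0 <= p <= m -> 0 <= f ->
  ((p * e + (p - m * (f * expR e)))%:E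
    <= p%:E * lne ((p / m)%:E / f%:E))%E.
Proof.
move=> /andP[]; rewrite le0r => /predU1P[-> m0 f0|p0 pm].
  rewrite mul0e lee_fin !mul0r !add0r oppr_le0 mulr_ge0// mulr_ge0// expR_ge0//.
have m0 : 0 < m by exact: lt_le_trans pm.
rewrite le0r => /predU1P[->|f0].
  by rewrite inver eqxx gt0_muley ?lte_fin ?divr_gt0//= gt0_muley ?lte_fin// leey.
rewrite inver gt_eqF// -EFinM lne_EFin ?divr_gt0// -EFinM lee_fin.
set q := m * (f * expR e) / p.
have q0 : 0 < q by rewrite divr_gt0// mulr_gt0// mulr_gt0// expR_gt0.
have : ln q <= q - 1.
  by have := @le_ln1Dx R (q - 1); rewrite (_ : 1 + (q - 1) = q); [apply; lra|ring].
have -> : ln q = e - ln (p / m / f).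
  have -> : q = expR e / (p / m / f) by rewrite /q; field; rewrite !gt_eqF.
  by rewrite ln_div ?posrE ?expR_gt0 ?divr_gt0// expRK.
move=> /(ler_wpM2l (ltW p0)); rewrite [X in _ <= X]mulrBr mulrCA mulfV ?gt_eqF//.
lra.
Qed.

Lemma gibbs_term_eq (p m f e : R) : 0 <= p -> 0 <= f -> p = m * (f * expR e) ->
  (p%:E * lne ((p / m)%:E / f%:E) = (p * e)%:E)%E.
Proof.
rewrite le0r => /predU1P[-> _ _|p0]; first by rewrite mul0e mul0r.
rewrite le0r => /predU1P[-> pE|f0 pE].
  by move: p0; rewrite pE mul0r mulr0 ltxx.
have m0 : m != 0 by apply: contraTneq p0 => m0; rewrite pE m0 mul0r ltxx.
rewrite inver gt_eqF// -EFinM (_ : p / m / f = expR e); last first.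
  by rewrite pE; field; rewrite m0 gt_eqF.
by rewrite lne_EFin ?expR_gt0// expRK -EFinM.
Qed.

Variables (p : S * U -> R) (phi0 e : S -> U -> R).
Hypotheses (p0 : forall x, 0 <= p x) (phi00 : forall s u, 0 <= phi0 s u).

(** The hypothesis says that phi0 exp e is a policy; the difference of the two
    sides is then the relative entropy of p with respect to that policy. *)
Lemma gibbs : (forall s, \sum_u phi0 s u * expR (e s u) = 1) ->
  ((\sum_s \sum_u p (s, u) * e s u)%:E <= rel_entropy p phi0)%E.
Proof.
move=> e1; rewrite /rel_entropy.
have -> : \sum_s \sum_u p (s, u) * e s u = \sum_s \sum_u (p (s, u) * e s u +
    (p (s, u) - (\sum_u' p (s, u')) * (phi0 s u * expR (e s u)))).
  apply: eq_bigr => s _; rewrite big_split /= -[LHS]addr0; congr (_ + _).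
  by rewrite sumrB -mulr_sumr e1 mulr1 subrr.
rewrite -sumEFin; apply: lee_sum => s _; rewrite -sumEFin.
apply: lee_sum => u _; apply: gibbs_term => //.
by rewrite p0 (bigD1 u)//= lerDl sumr_ge0.
Qed.

Lemma gibbs_eq :
  (forall s u, p (s, u) = (\sum_u' p (s, u')) * (phi0 s u * expR (e s u))) ->
  rel_entropy p phi0 = (\sum_s \sum_u p (s, u) * e s u)%:E.
Proof.
move=> pE; rewrite /rel_entropy -sumEFin; apply: eq_bigr => s _.
by rewrite -sumEFin; apply: eq_bigr => u _; exact: gibbs_term_eq.
Qed.

End Gibbs.

(** * Lagrangian duality for the relaxed program *)

Section Duality.
Context {R : realType} {S U : finType} (K : nat) {N : nat} (kappa : R).
Context (Y : S * U -> R) (r : nat -> R) (w : 'I_N -> nat -> R).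
Context (T : nat -> S * U -> S -> R) (nu00 : S * U -> R).
Context (phi0 : nat -> S -> U -> R).
Hypothesis kappa_gt0 : 0 < kappa.
Hypothesis T_pmf : forall k x, (k <= K)%N -> is_pmf (T k x).
Hypothesis nu00_pmf : is_pmf nu00.
Hypothesis phi0_pmf : forall k s, (1 <= k <= K)%N -> is_pmf (phi0 k s).

Notation L := (lagrangian K kappa Y r w T phi0).
Notation dual := (dual_function K kappa Y r w T nu00 phi0).
Notation bellman := (soft_bellman Y w T phi0).
Notation gstar := (g_opt K Y w T phi0).
Notation phipol := (policy_opt K Y w T phi0).
Implicit Types (lam gam : 'cV[R]_N) (h : nat -> S -> R) (nu : nat -> S * U -> R).

Definition state_marginal (p : S * U -> R) (s : S) : R := \sum_u p (s, u).

Definition expect_next k (f : S -> R) (x : S * U) : R :=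
  \sum_s' T k x s' * f s'.

(** The logarithmic density of the tilted policy with respect to phi0; the
    soft Bellman value is its normalising constant. *)
Definition tilt lam h k (s : S) (u : U) : R :=
  expect_next k (h k.+1) (s, u) + lam_check w lam k * Y (s, u)
  - bellman lam k (h k.+1) s.

Definition tilted lam h k (s : S) (u : U) : R :=
  phi0 k s u * expR (tilt lam h k s u).

Lemma partition_gt0 (p f : U -> R) : is_pmf p ->
  0 < \sum_u p u * expR (f u).
Proof.
move=> [p0 p1]; rewrite lt_neqAle sumr_ge0 ?andbT; last first.
  by move=> u _; rewrite mulr_ge0// expR_ge0.
apply/eqP => /esym/eqP; rewrite psumr_eq0; last first.
  by move=> u _; rewrite mulr_ge0// expR_ge0.
move=> /allP pz; suff : \sum_u p u = 0 by rewrite p1 => /eqP; rewrite oner_eq0.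
apply: big1 => u _; apply/eqP.
by have := pz u (mem_index_enum u); rewrite mulf_eq0 (gt_eqF (expR_gt0 _)) orbF.
Qed.

Lemma tilted_pmf lam h k s : (1 <= k <= K)%N -> is_pmf (tilted lam h k s).
Proof.
move=> kK; have phik := phi0_pmf s kK.
split=> [u|]; first by rewrite mulr_ge0 ?expR_ge0// phik.1.
rewrite /tilted /tilt; under eq_bigr do rewrite expRD expRN mulrA.
rewrite -mulr_suml /bellman lnK ?posrE; last exact: partition_gt0.
by rewrite mulfV// gt_eqF//; exact: partition_gt0.
Qed.

Definition gam_opt lam : 'cV[R]_N := - kappa^-1 *: lam.

Definition gamma_cost lam gam : R :=
  kappa / 2 * (\sum_n gam n 0 ^+ 2) + \sum_n lam n 0 * gam n 0.

Lemma gamma_cost_opt lam :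
  gamma_cost lam (gam_opt lam) = - ((2 * kappa)^-1 * \sum_n lam n 0 ^+ 2).
Proof.
rewrite /gamma_cost !mulr_sumr -big_split -sumrN; apply: eq_bigr => n _ /=.
by rewrite !mxE; field; rewrite gt_eqF.
Qed.

(** Completing the square. *)
Lemma gamma_cost_ge lam gam : gamma_cost lam (gam_opt lam) <= gamma_cost lam gam.
Proof.
rewrite gamma_cost_opt /gamma_cost !mulr_sumr -big_split -sumrN.
apply: ler_sum => n _ /=.
rewrite -subr_ge0; have -> : kappa / 2 * gam n 0 ^+ 2 + lam n 0 * gam n 0
  - - ((2 * kappa)^-1 * lam n 0 ^+ 2) =
  kappa / 2 * (gam n 0 + lam n 0 / kappa) ^+ 2 by field; rewrite gt_eqF.
by rewrite mulr_ge0 ?sqr_ge0// divr_ge0// ltW.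
Qed.

(** The Lagrangian without the relative entropies, the only terms that may be
    infinite. *)
Definition finite_part lam gam h nu : R :=
  (kappa / 2 * (\sum_n gam n 0 ^+ 2)
      + \sum_n lam n 0 *
          (gam n 0 + \sum_(1 <= k < K.+1) w n k * (r k - pairing (nu k) Y))
      + \sum_(1 <= k < K.+1) \sum_s'
          (\sum_u' nu k (s', u')
           - \sum_s \sum_u nu k.-1 (s, u) * T k.-1 (s, u) s') * h k s').

Definition ref_reward lam : R :=
  \sum_n lam n 0 * \sum_(1 <= k < K.+1) w n k * r k.

Lemma sum_lam_check lam (a : nat -> R) :
  \sum_n lam n 0 * (\sum_(1 <= k < K.+1) w n k * a k) =
  \sum_(1 <= k < K.+1) lam_check w lam k * a k.
Proof.
under eq_bigr do rewrite mulr_sumr.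
rewrite exchange_big; apply: eq_bigr => k _; rewrite mulr_suml.
by apply: eq_bigr => n _; rewrite mulrA.
Qed.

Lemma sum_flow (p : S * U -> R) k (f : S -> R) :
  \sum_s' (\sum_s \sum_u p (s, u) * T k (s, u) s') * f s' =
  pairing p (expect_next k f).
Proof.
under eq_bigr do rewrite pair_bigA mulr_suml.
rewrite exchange_big; apply: eq_bigr => -[s u] _ /=.
by rewrite mulr_sumr; apply: eq_bigr => s' _; rewrite mulrA.
Qed.

Lemma sum_mul_state_marginal (p : S * U -> R) (f : S -> R) :
  \sum_s \sum_u p (s, u) * f s = \sum_s state_marginal p s * f s.
Proof. by apply: eq_bigr => s _; rewrite mulr_suml. Qed.

(** Summation by parts in time. With B k the average of h (k+1) after a step
    from nu k, the tilt at time k contributes B k and the flow constraint into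
    time k contributes - B (k-1). The sum telescopes to - B 0, because B K = 0
    by the terminal condition on h. The reward terms of the tilt cancel those
    coming from the moment constraints. *)
Lemma finite_part_tilt lam gam h nu : h K.+1 = (fun=> 0) ->
  (\sum_(1 <= k < K.+1) \sum_s \sum_u nu k (s, u) * tilt lam h k s u)
    + finite_part lam gam h nu =
  gamma_cost lam gam + ref_reward lam - pairing (nu 0%N) (expect_next 0 (h 1%N))
  + \sum_(1 <= k < K.+1) \sum_s
      state_marginal (nu k) s * (h k s - bellman lam k (h k.+1) s).
Proof.
move=> hK.
pose B k := pairing (nu k) (expect_next k (h k.+1)).
have BK : B K = 0.
  rewrite /B /pairing big1// => x _; rewrite /expect_next hK big1 ?mulr0// => s _.
  by rewrite mulr0.
have tiltE k : \sum_s \sum_u nu k (s, u) * tilt lam h k s u =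
    B k + lam_check w lam k * pairing (nu k) Y
    - \sum_s state_marginal (nu k) s * bellman lam k (h k.+1) s.
  rewrite /tilt -sum_mul_state_marginal !pair_bigA mulr_sumr /B /pairing.
  rewrite -!big_split -sumrB /=.
  by apply: eq_bigr => -[s u] _ /=; ring.
have flowE k : \sum_s' (\sum_u' nu k.+1 (s', u')
      - \sum_s \sum_u nu k (s, u) * T k (s, u) s') * h k.+1 s' =
    \sum_s state_marginal (nu k.+1) s * h k.+1 s - B k.
  by under eq_bigr do rewrite mulrBl; rewrite sumrB sum_flow.
have flowsE : \sum_(1 <= k < K.+1) \sum_s' (\sum_u' nu k (s', u')
      - \sum_s \sum_u nu k.-1 (s, u) * T k.-1 (s, u) s') * h k s' =
    \sum_(1 <= k < K.+1) (\sum_s state_marginal (nu k) s * h k s - B k) - B 0%N.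
  rewrite !big_add1 /=.
  rewrite (eq_bigr (fun k =>
    (\sum_s state_marginal (nu k.+1) s * h k.+1 s - B k.+1)
    + (B k.+1 - B k))); last by move=> k _; rewrite flowE; ring.
  by rewrite big_split/= telescope_sumr// BK; ring.
rewrite /finite_part flowsE /gamma_cost /ref_reward.
under eq_bigr do rewrite tiltE.
have -> : \sum_n lam n 0 *
      (gam n 0 + \sum_(1 <= k < K.+1) w n k * (r k - pairing (nu k) Y)) =
    \sum_n lam n 0 * gam n 0
    + \sum_n lam n 0 * (\sum_(1 <= k < K.+1) w n k * r k)
    - \sum_(1 <= k < K.+1) lam_check w lam k * pairing (nu k) Y.
  rewrite -sum_lam_check -big_split -sumrB /=; apply: eq_bigr => n _.
  rewrite -mulrDr -mulrBr -addrA; congr (_ * (_ + _)).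
  by rewrite -sumrB; apply: eq_bigr => k _; rewrite mulrBr.
under [X in _ = _ + X]eq_bigr => k _.
  under eq_bigr do rewrite mulrBr.
  rewrite sumrB; over.
rewrite !sumrB big_split /= /B; ring.
Qed.

(** The part of the minimal Lagrangian that does not involve the Bellman
    gaps. *)
Definition base_value lam h : R :=
  gamma_cost lam (gam_opt lam) + ref_reward lam
  - pairing nu00 (expect_next 0 (h 1%N)).

Definition bellman_gap lam h k (s : S) : R := h k s - bellman lam k (h k.+1) s.

Lemma lagrangian_ge lam gam h nu : h K.+1 = (fun=> 0) ->
  pmf_sequences K nu00 nu ->
  ((base_value lam h
    + \sum_(1 <= k < K.+1) \sum_s state_marginal (nu k) s * bellman_gap lam h k s)%:E
    <= L nu gam lam h)%E.
Proof.
move=> hK [nu0 nu_pmf].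
pose E := \sum_(1 <= k < K.+1) \sum_s \sum_u nu k (s, u) * tilt lam h k s u.
apply: (@le_trans _ _ (E + finite_part lam gam h nu)%:E).
  rewrite finite_part_tilt// lee_fin lerD2r /base_value nu0 !lerD2r.
  exact: gamma_cost_ge.
rewrite EFinD leeD2r// -sumEFin big_nat [leRHS]big_nat.
apply: lee_sum => k kK; apply: gibbs.
- by case: (nu_pmf k kK).
- by move=> s; case: (phi0_pmf s kK).
- by move=> s; case: (tilted_pmf lam h s kK).
Qed.

Lemma lagrangian_tilted lam h nu : h K.+1 = (fun=> 0) ->
  pmf_sequences K nu00 nu ->
  (forall k s u, (1 <= k <= K)%N ->
    nu k (s, u) = state_marginal (nu k) s * tilted lam h k s u) ->
  L nu (gam_opt lam) lam h =
  (base_value lam h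
   + \sum_(1 <= k < K.+1) \sum_s state_marginal (nu k) s * bellman_gap lam h k s)%:E.
Proof.
move=> hK [nu0 nu_pmf] nuE.
transitivity ((\sum_(1 <= k < K.+1)
    \sum_s \sum_u nu k (s, u) * tilt lam h k s u) + finite_part lam (gam_opt lam) h nu)%:E.
  rewrite EFinD -sumEFin; congr (_ + _)%E.
  rewrite big_nat [RHS]big_nat; apply: eq_bigr => k kK; apply: gibbs_eq.
  - by case: (nu_pmf k kK).
  - by move=> s; case: (phi0_pmf s kK).
  - by move=> s u; exact: nuE.
by rewrite finite_part_tilt// /base_value nu0.
Qed.

(** Multipliers beyond the horizon do not enter the Lagrangian, so the terminal
    condition needed for the summation by parts can be imposed freely. *)
Definition truncate h k : S -> R := if (k <= K)%N then h k else fun=> 0.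

Lemma truncate_out h : truncate h K.+1 = fun=> 0.
Proof. by rewrite /truncate ltnn. Qed.

Lemma lagrangian_truncate nu gam lam h :
  L nu gam lam (truncate h) = L nu gam lam h.
Proof.
rewrite /lagrangian; congr (_ + (_ + _)%:E)%E.
rewrite big_nat [RHS]big_nat; apply: eq_bigr => k /andP[_ kK].
by rewrite /truncate -ltnS kK.
Qed.

Lemma state_inhabited : exists s : S, true.
Proof.
case: (pickP (@predT S)) => [s _|S0]; first by exists s.
have := nu00_pmf.2; rewrite big1 => [/eqP|[s u] _]; last by have := S0 s.
by rewrite eq_sym oner_eq0.
Qed.

Lemma sum_state_marginal (p : S * U -> R) :
  \sum_s state_marginal p s = \sum_x p x.
Proof. by rewrite /state_marginal pair_bigA; apply: eq_bigr => -[]. Qed.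

(** A minimiser is concentrated at each time k on one state sk k that minimises
    the Bellman gap, with the tilted law of the control there. The flow
    constraints are relaxed in the dual function, so the times can be treated
    separately. *)
Lemma dual_attained lam h : exists nu gam,
  pmf_sequences K nu00 nu /\ dual lam h = L nu gam lam h.
Proof.
have [s0 _] := state_inhabited; pose ht := truncate h.
pose sk k := [arg min_(s < s0) bellman_gap lam ht k s]%O.
have skP k s : bellman_gap lam ht k (sk k) <= bellman_gap lam ht k s.
  by rewrite /sk; case: arg_minP => // i _; apply.
pose nu k (x : S * U) : R := if k is 0%N then nu00 x
  else (x.1 == sk k)%:R * tilted lam ht k x.1 x.2.
have nuk k x : (1 <= k <= K)%N ->
    nu k x = (x.1 == sk k)%:R * tilted lam ht k x.1 x.2.
  by case: k.
have nuS k s : (1 <= k <= K)%N -> state_marginal (nu k) s = (s == sk k)%:R.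
  move=> kK; rewrite /state_marginal; under eq_bigr do rewrite nuk//=.
  by rewrite -mulr_sumr (tilted_pmf lam ht s kK).2 mulr1.
have sum_sk k (f : S -> R) : \sum_s (s == sk k)%:R * f s = f (sk k).
  rewrite (bigD1 (sk k))//= eqxx mul1r big1 ?addr0// => s /negPf->.
  by rewrite mul0r.
have nu_pmf : pmf_sequences K nu00 nu.
  split=> [|k kK]; first exact/funext.
  split=> [x|].
    rewrite nuk// mulr_ge0//; exact: (tilted_pmf lam ht x.1 kK).1.
  rewrite -sum_state_marginal; under eq_bigr do rewrite nuS// -[_%:R]mulr1.
  by rewrite sum_sk.
exists nu, (gam_opt lam); split=> //; apply/eqP; rewrite eq_le; apply/andP; split.
  by apply: ereal_inf_lbound; exists nu => //; exists (gam_opt lam).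
apply/ereal_infP => _ [mu mu_pmf [gam _ <-]].
rewrite -lagrangian_truncate -[leRHS]lagrangian_truncate.
rewrite lagrangian_tilted; [|exact: truncate_out|exact: nu_pmf|]; last first.
  by move=> k s u kK; rewrite nuS// nuk.
apply: le_trans (lagrangian_ge _ _ (truncate_out h) mu_pmf).
rewrite lee_fin lerD2l big_nat [leRHS]big_nat.
apply: ler_sum => k kK.
under eq_bigr do rewrite nuS//.
(* The smallest gap is below the average of the gaps under mu k. *)
rewrite sum_sk -[leLHS]mul1r -(mu_pmf.2 k kK).2 -sum_state_marginal mulr_suml.
apply: ler_sum => s _; apply: ler_wpM2l => //.
by apply: sumr_ge0 => u _; exact: (mu_pmf.2 k kK).1.
Qed.

(** ** The optimal multipliers and their policy *)

Lemma g_opt_out lam : gstar lam K.+1 = fun=> 0.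
Proof. by rewrite /g_opt subnn. Qed.

Lemma g_opt_rec lam k : (1 <= k <= K)%N ->
  gstar lam k = bellman lam k (gstar lam k.+1).
Proof.
move=> /andP[k1 kK]; rewrite /g_opt subSS subSn//=.
by rewrite subKn.
Qed.

Lemma bellman_gap_g_opt lam k s : (1 <= k <= K)%N ->
  bellman_gap lam (gstar lam) k s = 0.
Proof. by move=> kK; rewrite /bellman_gap g_opt_rec// subrr. Qed.

Lemma sum_bellman_gap_g_opt lam nu :
  \sum_(1 <= k < K.+1) \sum_s
    state_marginal (nu k) s * bellman_gap lam (gstar lam) k s = 0.
Proof.
rewrite big_nat big1// => k kK; rewrite big1// => s _.
by rewrite bellman_gap_g_opt// mulr0.
Qed.

Definition flow_balanced nu := forall k s', (1 <= k <= K)%N ->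
  \sum_u' nu k (s', u') = \sum_s \sum_u nu k.-1 (s, u) * T k.-1 (s, u) s'.

(** What weak duality rests on: at balanced sequences the Lagrangian is
    independent of h and affine in lam. *)
Lemma lagrangian_balanced nu gam lam h : flow_balanced nu ->
  L nu gam lam h = (\sum_(1 <= k < K.+1) rel_entropy (nu k) (phi0 k) +
   (kappa / 2 * (\sum_n gam n 0 ^+ 2)
      + \sum_n lam n 0 *
          (gam n 0 + \sum_(1 <= k < K.+1) w n k * (r k - pairing (nu k) Y)))%:E)%E.
Proof.
move=> nuT; rewrite /lagrangian [X in (_ + _ + X)%:E](_ : _ = 0) ?addr0//.
rewrite big_nat big1// => k kK; rewrite big1// => s' _.
by rewrite nuT// subrr mul0r.
Qed.

Lemma state_marginal_marginals phi k s' : (forall s, is_pmf (phi k.+1 s)) ->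
  state_marginal (marginals T nu00 phi k.+1) s' =
  \sum_x marginals T nu00 phi k x * T k x s'.
Proof.
move=> phi_pmf; rewrite /state_marginal /= exchange_big /=; apply: eq_bigr => x _.
by rewrite -mulr_sumr (phi_pmf s').2 mulr1.
Qed.

Section Policy.
Variable phi : nat -> S -> U -> R.
Hypothesis phi_pmf : forall k s, (1 <= k <= K)%N -> is_pmf (phi k s).
Notation mar := (marginals T nu00 phi).

Lemma marginals_factor k s u : (1 <= k <= K)%N ->
  mar k (s, u) = state_marginal (mar k) s * phi k s u.
Proof.
case: k => // k kK; rewrite state_marginal_marginals => [|s']; last exact: phi_pmf.
by rewrite /= -mulr_suml.
Qed.

Lemma marginals_pmf : pmf_sequences K nu00 mar.
Proof.
split=> //; elim=> [//|k IH] kK.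
have mk : is_pmf (mar k).
  by case: k IH kK => [//|k] IH /andP[_ kK]; apply: IH; rewrite /= ltnW.
have kK' : (k <= K)%N by rewrite ltnW//; case/andP: kK.
split=> [[s u]|].
  rewrite /= sumr_ge0// => x _; rewrite mulr_ge0//; last exact: (phi_pmf s kK).1.
  by rewrite mulr_ge0//; [exact: mk.1|exact: (T_pmf x kK').1].
rewrite -sum_state_marginal.
under eq_bigr do
  [rewrite state_marginal_marginals; last by move=> s'; exact: phi_pmf].
rewrite exchange_big -mk.2; apply: eq_bigr => x _ /=.
by rewrite -mulr_sumr (T_pmf x kK').2 mulr1.
Qed.

Lemma marginals_balanced : flow_balanced mar.
Proof.
move=> [//|k] s' kK; transitivity (state_marginal (mar k.+1) s') => //.
rewrite state_marginal_marginals => [|s]; last exact: phi_pmf.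
by rewrite pair_bigA; apply: eq_bigr => -[].
Qed.

End Policy.

Lemma policy_opt_tilted lam k s u : (1 <= k <= K)%N ->
  phipol lam k s u = tilted lam (gstar lam) k s u.
Proof. by move=> kK; rewrite /policy_opt /tilted /tilt -g_opt_rec. Qed.

Lemma policy_opt_pmf lam k s : (1 <= k <= K)%N -> is_pmf (phipol lam k s).
Proof.
move=> kK; rewrite (_ : phipol lam k s = tilted lam (gstar lam) k s).
  exact: tilted_pmf.
by apply/funext => u; exact: policy_opt_tilted.
Qed.

Notation nustar lam := (marginals T nu00 (phipol lam)).

Definition opt_value lam : R := base_value lam (gstar lam).

(** For h = g_opt the Bellman gaps vanish and the entropy bound is tight; any
    other h gives the same value since the marginals are balanced. *)
Lemma lagrangian_saddle lam h :
  L (nustar lam) (gam_opt lam) lam h = (opt_value lam)%:E.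
Proof.
have phiP := @policy_opt_pmf lam.
rewrite lagrangian_balanced; last exact: marginals_balanced.
(* Reinstate the flow terms with the multiplier that closes the gaps. *)
rewrite -(lagrangian_balanced _ _ (gstar lam)); last exact: marginals_balanced.
rewrite lagrangian_tilted ?sum_bellman_gap_g_opt.
- by rewrite addr0.
- exact: g_opt_out.
- exact: marginals_pmf.
- by move=> k s u kK; rewrite marginals_factor// policy_opt_tilted.
Qed.

Lemma dual_le_lagrangian lam h nu gam : pmf_sequences K nu00 nu ->
  (dual lam h <= L nu gam lam h)%E.
Proof. by move=> nuP; apply: ereal_inf_lbound; exists nu => //; exists gam. Qed.

Lemma dual_le lam h : (dual lam h <= (opt_value lam)%:E)%E.
Proof.
rewrite -(lagrangian_saddle lam h); apply: dual_le_lagrangian.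
by apply: marginals_pmf => k s; exact: policy_opt_pmf.
Qed.

Lemma dual_g_opt lam : dual lam (gstar lam) = (opt_value lam)%:E.
Proof.
apply/eqP; rewrite eq_le dual_le/=; apply/ereal_infP => _ [nu nuP [gam _ <-]].
apply: le_trans (lagrangian_ge _ _ (g_opt_out lam) nuP).
by rewrite sum_bellman_gap_g_opt addr0.
Qed.

Lemma max_dualE lam :
  max_dual K kappa Y r w T nu00 phi0 lam = (opt_value lam)%:E.
Proof.
apply/eqP; rewrite eq_le; apply/andP; split.
  by apply/ereal_supP => _ [h _ <-]; exact: dual_le.
by rewrite -dual_g_opt; apply: ereal_sup_ubound; exists (gstar lam).
Qed.

(** The slope in lam of the Lagrangian at the minimisers for lam. *)
Definition residual lam n : R :=
  gam_opt lam n 0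
  + \sum_(1 <= k < K.+1) w n k * (r k - pairing (nustar lam k) Y).

(** The minimisers for lam are admissible in the infimum that defines the dual
    function at lam', and there the Lagrangian exceeds its value at lam by the
    linear form of slope residual lam. *)
Lemma opt_value_supergradient : supergradient opt_value residual.
Proof.
move=> lam lam'; set nu := nustar lam.
have phiP := @policy_opt_pmf lam.
have nuP : pmf_sequences K nu00 nu by exact: marginals_pmf.
have nuT : flow_balanced nu by exact: marginals_balanced.
have := dual_le_lagrangian lam' (gstar lam') (gam_opt lam) nuP.
have := lagrangian_saddle lam (gstar lam).
rewrite dual_g_opt !lagrangian_balanced//.
(* The entropy sum is finite because the Lagrangian at lam is. *)
case: (\sum_(1 <= k < K.+1) _)%E => [e||]//.
rewrite -!EFinD lee_fin => -[<-] /le_trans; apply.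
rewrite -!addrA !lerD2l /linear_form -big_split /=; apply: ler_sum => n _.
have -> : (lam' - lam) n 0 = lam' n 0 - lam n 0 by rewrite !mxE.
by rewrite mulrBl addrC subrK.
Qed.

(** ** Continuity in the multiplier *)

Lemma lam_check_continuous k : continuous (fun lam => lam_check w lam k).
Proof. exact: (@linear_form_continuous R N (w ^~ k)). Qed.

Lemma reward_continuous (f : 'cV[R]_N -> S -> R) k x :
  (forall s, continuous (f ^~ s)) ->
  continuous (fun lam =>
    expect_next k (f lam) x + lam_check w lam k * Y x).
Proof.
move=> fc lam.
have nextc : {for lam, continuous (fun lam => expect_next k (f lam) x)}.
  apply: continuous_at_sum => s.
  exact: (cvgM (cvg_cst (T k x s)) (fc s lam)).
exact: (cvgD nextc (cvgM (lam_check_continuous (x := lam)) (cvg_cst (Y x)))).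
Qed.

Lemma soft_bellman_continuous (f : 'cV[R]_N -> S -> R) k s :
  (1 <= k <= K)%N -> (forall s, continuous (f ^~ s)) ->
  continuous (fun lam => bellman lam k (f lam) s).
Proof.
move=> kK fc lam.
pose Z lam := \sum_u phi0 k s u *
  expR (expect_next k (f lam) (s, u) + lam_check w lam k * Y (s, u)).
have Zc : {for lam, continuous Z}.
  apply: continuous_at_sum => u.
  have rc := reward_continuous (k := k) (x := (s, u)) fc (x0 := lam).
  exact: (cvgM (cvg_cst (phi0 k s u))
            (continuous_comp rc (@continuous_expR R _))).
apply: (continuous_comp Zc); apply: continuous_ln.
exact/partition_gt0/phi0_pmf.
Qed.

Lemma g_opt_continuous k s : (0 < k)%N -> continuous (fun lam => gstar lam k s).
Proof.
rewrite /g_opt => k0; have : (K.+1 - k <= K)%N.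
  by rewrite leq_subLR -(add1n K) leq_add2r.
(* Induction on the time to go, starting from the terminal value 0. *)
elim: (K.+1 - k)%N s => [|j IH] s jK; first exact: cst_continuous.
apply: soft_bellman_continuous => [|s'].
  by rewrite subn_gt0 jK leq_subr.
by apply: IH; exact: ltnW.
Qed.

Lemma policy_opt_continuous k s u : (0 < k)%N ->
  continuous (fun lam => phipol lam k s u).
Proof.
move=> k0 lam.
have rc := reward_continuous (f := fun lam => gstar lam k.+1) (k := k)
  (x := (s, u)) (fun s' => g_opt_continuous (s := s') (ltn0Sn k)) (x0 := lam).
have tc : {for lam, continuous (fun lam =>
    expect_next k (gstar lam k.+1) (s, u) + lam_check w lam k * Y (s, u)
    - gstar lam k s)}.
  exact: (cvgB rc (g_opt_continuous (s := s) k0 (x := lam))).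
exact: (cvgM (cvg_cst (phi0 k s u))
          (continuous_comp tc (@continuous_expR R _))).
Qed.

Lemma marginals_continuous k x : continuous (fun lam => nustar lam k x).
Proof.
elim: k x => [|k IH] x lam.
  exact: (@cst_continuous 'cV[R]_N R (nu00 x)).
apply: (continuous_at_sum (F := fun lam y =>
  nustar lam k y * T k y x.1 * phipol lam k.+1 x.1 x.2)) => y.
have phic : {for lam, continuous (fun lam => phipol lam k.+1 x.1 x.2)}.
  exact: policy_opt_continuous.
exact: (cvgM (cvgM (IH y lam) (cvg_cst (T k y x.1))) phic).
Qed.

Lemma residual_continuous n : continuous (residual ^~ n).
Proof.
move=> lam.
have gamc : continuous_at lam (fun lam => gam_opt lam n 0).
  rewrite [X in continuous_at _ X](_ : _ = fun lam => - kappa^-1 * lam n 0).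
    exact: (cvgM (cvg_cst (- kappa^-1)) (@coord_continuous R N 1 n 0 lam)).
  by apply/funext => mu; rewrite mxE.
have pairc k : {for lam, continuous (fun lam => pairing (nustar lam k) Y)}.
  apply: continuous_at_sum => x.
  have marc := marginals_continuous (k := k) (x := x).
  exact: (cvgM (marc lam) (cvg_cst (Y x))).
have sumc : {for lam, continuous (fun lam =>
    \sum_(1 <= k < K.+1) w n k * (r k - pairing (nustar lam k) Y))}.
  apply: continuous_at_sum => k.
  exact: (cvgM (cvg_cst (w n k)) (cvgB (cvg_cst (r k)) (pairc k))).
exact: (cvgD gamc sumc).
Qed.

End Duality.

Theorem proposition2p2 (R : realType) (S U : finType) (K N : nat) (kappa : R)
    (Y : S * U -> R) (r : nat -> R) (w : 'I_N -> nat -> R) (rhat : 'cV[R]_N)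
    (T : nat -> S * U -> S -> R) (nu00 : S * U -> R)
    (phi0 : nat -> S -> U -> R)
    (K_ge1 : (1 <= K)%N) (N_ge1 : (1 <= N)%N) (kappa_gt0 : 0 < kappa)
    (rhatE : forall n, rhat n 0 = \sum_(1 <= k < K.+1) w n k * r k)
    (T_pmf : forall k x, (k <= K)%N -> is_pmf (T k x))
    (nu00_pmf : is_pmf nu00)
    (phi0_pmf : forall k s, (1 <= k <= K)%N -> is_pmf (phi0 k s)) :
  let L := lagrangian K kappa Y r w T phi0 in
  let dual := dual_function K kappa Y r w T nu00 phi0 in
  let phistar := max_dual K kappa Y r w T nu00 phi0 in
  let g := g_opt K Y w T phi0 in
  let phi := policy_opt K Y w T phi0 in
  let nu := fun lam => marginals T nu00 (phi lam) in
  (* the infimum defining the dual function is a minimum *)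
  (forall lam h, exists mu gam,
      pmf_sequences K nu00 mu /\ dual lam h = L mu gam lam h) /\
  (* (i) *)
  (forall lam,
      [/\ g lam K.+1 = fun=> 0,
          forall k, (1 <= k <= K)%N ->
            g lam k = soft_bellman Y w T phi0 lam k (g lam k.+1)
        & forall h, (dual lam h <= dual lam (g lam))%E]) /\
  (* (ii) *)
  ((forall lam, phistar lam =
      (\sum_n lam n 0 * rhat n 0 - (2 * kappa)^-1 * (\sum_n lam n 0 ^+ 2)
       - pairing nu00 (G_opt K Y w T phi0 lam 1))%:E) /\
   concave_function (fun lam => fine (phistar lam))) /\
  (* (iii) *)
  [/\ continuously_differentiable (fun lam => fine (phistar lam)),
      forall lam k s, (1 <= k <= K)%N -> is_pmf (phi lam k s)
    & forall lam n,
        partial_derivative n (fun lam => fine (phistar lam)) lam =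
        rhat n 0 - kappa^-1 * lam n 0
        - \sum_(1 <= k < K.+1) w n k * pairing (nu lam k) Y].
Proof.
move=> L dual phistar g phi nu.
have phistarE lam : phistar lam = _ :=
  max_dualE Y r w kappa_gt0 T_pmf nu00_pmf phi0_pmf lam.
have finE : (fun lam => fine (phistar lam)) = _
  := funext (fun lam => congr1 fine (phistarE lam)).
have ref lam : ref_reward K r w lam = \sum_n lam n 0 * rhat n 0.
  by apply: eq_bigr => n _; rewrite rhatE.
have super := opt_value_supergradient Y r w kappa_gt0 T_pmf nu00_pmf phi0_pmf.
have [C1 partialE] : continuously_differentiable _ /\ _ :=
  supergradient_C1 super (fun n => residual_continuous phi0_pmf (n := n)).
split; first exact: dual_attained.
split=> [lam|].
  split=> [|k kK|h]; [exact: g_opt_out|exact: g_opt_rec|].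
  by rewrite /dual dual_g_opt//; exact: dual_le.
split.
  split=> [lam|]; last by rewrite finE; exact: supergradient_concave super.
  rewrite phistarE /opt_value /base_value gamma_cost_opt// ref.
  by congr (_ - _)%:E; rewrite addrC.
rewrite finE; split=> [//|lam k s kK|lam n]; first exact: policy_opt_pmf.
rewrite partialE /residual mxE rhatE.
under eq_bigr do rewrite mulrBr.
by rewrite sumrB; ring.
Qed.
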